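(* For all integers $r\ge 1$ and $m\ge r$, $$\sum_{p=0}^{m-r}\Theta^{m}_{p,r}\,(p+1)=-\frac{\Gamma\left(-r-\frac12\right)(m+r+1)!}{2\sqrt{\pi}\,(m-r)!}.$$ In particular, $$\sum_{p=0}^{m-1}(-1)^{m-p}(p+1)^{2}\,\theta^{m}_{p,1}=-\frac{(m+2)(m+1)m}{6}\quad(m\ge1),$$ $$\sum_{p=0}^{m-2}(-1)^{m-p}(p+1)^{2}(m-p)(m+p+2)\,\theta^{m}_{p,2}=\frac{(m-1)m(m+1)(m+2)(m+3)}{15}\quad(m\ge2),$$ $$\sum_{p=0}^{m-3}(-1)^{m-p}(p+1)^{2}(p-m-1)(p-m+1)(m+p+1)(m+p+3)\,\theta^{m}_{p,3}=-\frac{4(m-2)(m-1)m(m+1)(m+2)(m+3)(m+4)}{105}\quad(m\ge3).$$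
   Context: $\Gamma$ is the Gamma function and $(x)_k=\Gamma(x+k)/\Gamma(x)$ for $k=0,1,2,\dots$ is the Pochhammer symbol. For integers $m\ge r\ge1$ and $0\le p\le m-r$, set $\theta^{m}_{p,r}=1$ if $m-p-r$ is even and $\theta^{m}_{p,r}=0$ otherwise, and $$\Theta^{m}_{p,r}=\frac{(-1)^{m-p}\,2^{2r}\,(p+1)\left(\frac{m+p-r}{2}+2\right)_{r-1}(r)_{\frac{m-p-r}{2}}}{\left(\frac{m-p-r}{2}\right)!}\,\theta^{m}_{p,r},$$ so that $\Theta^m_{p,r}=0$ when $m-p-r$ is odd. *)

(* Defs.v *)
From mathcomp Require Import all_boot all_order all_algebra.
From mathcomp Require Import all_classical all_reals all_analysis.

Set Implicit Arguments.
Unset Strict Implicit.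
Unset Printing Implicit Defensive.

Import Order.TTheory GRing.Theory Num.Theory.

Local Open Scope ring_scope.

(* Euler's integral of the second kind; it is only meaningful for 0 < x. *)
Definition euler_integral (R : realType) (x : R) : R :=
  \int[lebesgue_measure]_(t in `]0, +oo[) (t `^ (x - 1) * expR (- t)).

(* The Gamma function on the real line: Euler's integral for 0 < x, continued
   to the left by the functional equation
     Gamma x = Gamma (x + n) / (x * (x + 1) * ... * (x + n - 1)).
   Num.truncn is 0 on negative reals, so Num.truncn (1 - x) is the least n with
   0 < x + n. At the poles 0, -1, -2, ... the product vanishes and the value is
   the meaningless 0. *)
Definition Gamma (R : realType) (x : R) : R :=
  let n := Num.truncn (1 - x) in
  euler_integral (x + n%:R) / \prod_(i < n) (x + i%:R).

Definition pochhammer (R : realType) (x : R) (k : nat) : R :=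
  Gamma (x + k%:R) / Gamma x.

(* theta and Theta are meant for p + r <= m, so that no natural-number
   subtraction below is truncated. *)
Definition theta (R : realType) (m p r : nat) : R :=
  (if odd (m - p - r) then 0 else 1).

(* When m - p - r is odd, the rounding in _./2 is immaterial since the factor
   theta is 0. *)
Definition Theta (R : realType) (m p r : nat) : R :=
  (-1) ^+ (m - p) * 2 ^+ (2 * r) * p.+1%:R
  * pochhammer ((m + p - r)%:R / 2 + 2) (r - 1)
  * pochhammer r%:R (m - p - r)./2
  / ((m - p - r)./2)`!%:R
  * theta R m p r.

(* Main.v *)
(* Write m = n + r with r = s + 1 and p = n - 2k. Then (Theta m p r) * (p + 1) is
   (-4)^r s! times (M - 2k)^2 a_k a_(M-k), where M = n + 1 and
   a_k = 'C(k + s, s) is the k-th coefficient of (1 - x)^(-r). This summand is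
   symmetric under k <-> M - k and vanishes at the midpoint, so twice the sum is
   the full convolution over 0 <= k <= M, which is evaluated by expanding
   (M - 2k)^2 = M^2 - 4 k (M - k) and using k a_k = r 'C(k + s, r).
   The Gamma values needed are those at positive integers (an explicit primitive
   of x^n e^(-x)) and at 1/2 - n (recursion down from Gamma(1/2) = sqrt pi, which
   is the Gaussian integral after t = u^2). *)

Require Import Defs.
From mathcomp Require Import all_boot all_order all_algebra.
From mathcomp Require Import all_classical all_reals all_analysis.
From mathcomp Require Import measurable_realfun gauss_integral.
From mathcomp Require Import ring lra zify.

Set Implicit Arguments.
Unset Strict Implicit.
Unset Printing Implicit Defensive.

Import Order.TTheory GRing.Theory Num.Theory.
Import numFieldNormedType.Exports.

(** * Binomial convolutions *)

(** Coefficient of x^n in (1 - x)^(-a-1) (1 - x)^(-b-1) = (1 - x)^(-a-b-2), obtained here by a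
    double induction from Pascal's rule. *)
Lemma sum_bin_conv a b n :
  \sum_(k < n.+1) 'C(k + a, a) * 'C(n - k + b, b)
  = 'C(n + a + b + 1, a + b + 1).
Proof.
elim: b n => [n|b IHb n].
  under eq_bigr do rewrite bin0 muln1.
  rewrite !addn0 !addn1.
  elim: n => [|n IHn]; first by rewrite big_ord_recl big_ord0 !add0n addn0 !binn.
  by rewrite big_ord_recr /= IHn addSn [in RHS]binS.
elim: n => [|n IHn].
  by rewrite big_ord_recl big_ord0 !add0n addn0 !binn.
have -> : n.+1 + a + b.+1 + 1 = (n + a + b.+1 + 1).+1 by lia.
have -> : a + b.+1 + 1 = (a + b + 1).+1 by lia.
(* Pascal's rule splits the right side into the values given by [IHn] (same [b.+1], smaller [n]) and
   by [IHb] (at [n.+1]). *)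
rewrite binS -[in X in X + _](_ : a + b.+1 + 1 = (a + b + 1).+1); last by lia.
rewrite -IHn.
have -> : n + a + b.+1 + 1 = n.+1 + a + b + 1 by lia.
rewrite -IHb big_ord_recr [X in _ = _ + X]big_ord_recr /= subnn !binn.
rewrite addnA -big_split /=.
congr (_ + _); apply: eq_bigr => i _.
rewrite -mulnDr (subSn (ltnSE (ltn_ord i))); congr (_ * _).
by rewrite addnS binS addSn addnS addnC.
Qed.

Lemma sum_even (V : nmodType) (f : nat -> V) n :
  (\sum_(i < n.+1) (if odd i then 0 else f i./2) = \sum_(k < n./2.+1) f k)%R.
Proof.
elim: n => [|n IHn]; first by rewrite !big_ord_recl !big_ord0.
rewrite big_ord_recr IHn /= uphalf_half.
by case: (odd n) => /=; rewrite ?addr0 // add1n [RHS]big_ord_recr.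
Qed.

Local Open Scope ring_scope.

Section SqrConv.
Variable R : numDomainType.

Lemma sum_half_sym (f : nat -> R) n :
  (forall k, (k <= n.+1)%N -> f (n.+1 - k)%N = f k) ->
  (odd n -> f (n./2.+1) = 0) ->
  \sum_(k < n.+2) f k = 2 * \sum_(k < n./2.+1) f k.
Proof.
move=> fsym fmid.
pose h := n./2.+1.
have hE : n.+2 = (odd n + (h + h))%N.
  by rewrite /h addnn -[in LHS](odd_double_half n) doubleS; lia.
rewrite -!(big_mkord xpredT f) -/h.
(* Lower half, middle, upper half: the middle block has [odd n] indices, so it is either empty or
   the single midpoint. *)
rewrite (@big_cat_nat _ _ _ h) //=; last by rewrite hE; lia.
rewrite (@big_cat_nat _ _ _ (odd n + h) h) /=; [| lia | by rewrite hE; lia].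
have -> : \sum_(h <= k < odd n + h) f k = 0.
  case: (odd n) fmid => /= fmid; last by rewrite add0n big_geq.
  by rewrite add1n big_nat1 fmid.
rewrite add0r mulrDl mul1r; congr (_ + _).
rewrite -{1}[(odd n + h)%N]add0n. rewrite big_addn hE addnA addKn.
rewrite big_nat_rev /= add0n; apply: eq_big_nat => k /andP[_ kh].
rewrite -fsym; last by lia.
by congr f; lia.
Qed.

Lemma sum_sqr_bin_conv s n :
  \sum_(k < n.+1) (n%:R - 2 * k%:R) ^+ 2 * ('C(n - k + s, s) * 'C(k + s, s))%:R
  = 2 * s.+1%:R * 'C(n + 2 * s + 2, 2 * s + 3)%:R :> R.
Proof.
(* Each of the weights k and n - k is absorbed into its binomial, raising the lower index to [s.+1].
   The two end terms vanish, which leaves a convolution of length shorter by two. *)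
have prodE : (\sum_(k < n.+1) k * (n - k) * ('C(n - k + s, s) * 'C(k + s, s))
    = s.+1 ^ 2 * 'C(n + 2 * s + 1, 2 * s + 3))%N.
  have kbin k : (k.+1 * 'C(k.+1 + s, s) = s.+1 * 'C(k + s.+1, s.+1))%N.
    by rewrite addnS -addSn mul_bin_left addnK.
  case: n => [|[|n]].
  - by rewrite big_ord_recl big_ord0 mul0n bin_small ?muln0 //; lia.
  - by rewrite !big_ord_recl big_ord0 /= subnn muln0 !mul0n bin_small ?muln0//; lia.
  rewrite big_ord_recr big_ord_recl /= subnn muln0 !mul0n add0n addn0.
  transitivity (s.+1 ^ 2 *
      \sum_(k < n.+1) 'C(k + s.+1, s.+1) * 'C(n - k + s.+1, s.+1))%N.
    rewrite big_distrr; apply: eq_bigr => k _ /=.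
    rewrite /bump /= add1n subSS (subSn (ltnSE (ltn_ord k))).
    rewrite (mulnC 'C(_.+1 + s, s)) mulnACA !kbin; ring.
  rewrite sum_bin_conv; congr (_ * 'C(_, _))%N; lia.
have convE : (\sum_(k < n.+1) 'C(n - k + s, s) * 'C(k + s, s))%N
    = 'C(n + 2 * s + 1, 2 * s + 1).
  under eq_bigr do rewrite mulnC.
  by rewrite sum_bin_conv; congr ('C(_, _)); lia.
have -> : \sum_(k < n.+1) (n%:R - 2 * k%:R) ^+ 2 *
      ('C(n - k + s, s) * 'C(k + s, s))%:R =
    n%:R ^+ 2 * 'C(n + 2 * s + 1, 2 * s + 1)%:R
    - 4 * (s.+1 ^ 2 * 'C(n + 2 * s + 1, 2 * s + 3))%:R :> R.
  rewrite -convE -prodE !natr_sum !mulr_sumr -sumrB; apply: eq_bigr => k _.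
  rewrite !natrM natrB; last by rewrite -ltnS.
  by ring.
(* Absorption again, to bring everything to the lower indices 2s + 2 and 2s + 3. *)
have e1 : n%:R * 'C(n + 2 * s + 1, 2 * s + 1)%:R =
    (2 * s + 2)%:R * 'C(n + 2 * s + 1, 2 * s + 2)%:R :> R.
  have := mul_bin_left (n + 2 * s + 1) (2 * s + 1).
  rewrite (_ : (n + 2 * s + 1 - (2 * s + 1) = n)%N); last by lia.
  by rewrite -addnS -!natrM => <-.
have e2 : (n%:R - 1) * 'C(n + 2 * s + 1, 2 * s + 2)%:R =
    (2 * s + 3)%:R * 'C(n + 2 * s + 1, 2 * s + 3)%:R :> R.
  case: n {prodE convE e1} => [|n]; first by rewrite !bin_small ?mulr0//; lia.
  have := mul_bin_left (n.+1 + 2 * s + 1) (2 * s + 2).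
  rewrite (_ : (n.+1 + 2 * s + 1 - (2 * s + 2) = n)%N); last by lia.
  by rewrite -addnS -natr1 addrK -!natrM => <-.
have -> : 'C(n + 2 * s + 2, 2 * s + 3) =
    ('C(n + 2 * s + 1, 2 * s + 3) + 'C(n + 2 * s + 1, 2 * s + 2))%N.
  by rewrite [in LHS]addnS [(2 * s + 3)%N]addnS binS !addn1 !addn2 ?addnS.
rewrite expr2 -mulrA e1; move: e2.
set X := 'C(_, 2 * s + 2)%:R; set Y := 'C(_, 2 * s + 3)%:R => e.
apply/eqP; rewrite -subr_eq0 !(natrD, natrM) -/X -/Y; apply/eqP.
(* After Pascal's rule on the right, the two sides differ by a multiple of the relation [e2]. *)
transitivity (2 * s.+1%:R * ((n%:R - 1) * X - (2 * s + 3)%:R * Y)); first by ring.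
by rewrite e subrr mulr0.
Qed.

(** With p = n - 2k, the summand is that of the convolution of length [n.+1] at index k, and p >= 0
    selects the lower half of the indices. *)
Lemma sum_sqr_bin_parity s n :
  \sum_(0 <= p < n.+1) p.+1%:R ^+ 2 *
    (if odd (n - p) then 0
     else ('C((n + p)./2.+1 + s, s) * 'C((n - p)./2 + s, s))%:R)
  = s.+1%:R * 'C(n + 2 * s + 3, 2 * s + 3)%:R :> R.
Proof.
pose f k : R := (n.+1%:R - 2 * k%:R) ^+ 2 *
  ('C(n.+1 - k + s, s) * 'C(k + s, s))%:R.
have two0 : 2 != 0 :> R by rewrite pnatr_eq0.
(* Doubling replaces a division, as [R] is only a domain. *)
apply: (mulfI two0).
transitivity (2 * \sum_(k < n./2.+1) f k); last first.
  rewrite -sum_half_sym.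
  - by rewrite sum_sqr_bin_conv mulrA; congr (_ * 'C(_, _)%:R); lia.
  - by move=> k kn; rewrite /f natrB// subKn// [in RHS]mulnC; congr (_ * _); ring.
  - move=> on; rewrite /f (_ : n.+1%:R - _ = 0) ?expr0n ?mul0r//.
    by rewrite -natrM; apply/eqP; rewrite subr_eq0 eqr_nat; lia.
congr (2 * _).
rewrite -sum_even big_nat_rev /= add0n big_mkord; apply: eq_bigr => i _.
have lein : (i <= n)%N by rewrite -ltnS.
rewrite subSS subKn//; case: ifP => oi; first by rewrite mulr0.
have iE := odd_double_half i; rewrite oi add0n in iE.
rewrite /f -natrM -natrB; last by lia.
congr (_%:R ^+ 2 * ('C(_ + s, s) * _)%:R); lia.
Qed.
End SqrConv.

(** * Gamma at positive integers and at 1/2 - n *)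

Section gamma.
Local Open Scope classical_set_scope.
Context {R : realType}.
Implicit Types (x t : R) (n : nat).

Lemma cvg_exprn_expRN n : x ^+ n * expR (- x) @[x --> +oo] --> (0 : R).
Proof.
apply/cvgrPdist_le => e e0; near=> x.
have x0 : 0 < x by near: x; apply: nbhs_pinfty_gt; exact: num_real.
rewrite sub0r normrN ger0_norm ?(mulr_ge0, exprn_ge0, expR_ge0, ltW x0)//.
rewrite expRN ler_pdivrMr ?expR_gt0//.
have f0 : 0 < n.+1`!%:R :> R by rewrite ltr0n fact_gt0.
(* One term of the exponential series gives x^n e^(-x) <= (n+1)! / x for x > 0. *)
have ex : x ^+ n.+1 / n.+1`!%:R <= expR x.
  by have := @expR_ge1Dxn R x n (ltW x0); lra.
apply: (@le_trans _ _ (e * (x ^+ n.+1 / n.+1`!%:R))); last by rewrite ler_pM2l.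
rewrite exprS !mulrA mulrAC ler_peMl ?exprn_ge0 ?(ltW x0)//.
rewrite ler_pdivlMr// mul1r -ler_pdivrMl; last by [].
by near: x; apply: nbhs_pinfty_ge; exact: num_real.
Unshelve. all: by end_near. Qed.

(** Minus the upper incomplete Gamma function of order [n.+1], unfolded by integration by parts: the
    primitive of x^n e^(-x) that vanishes at infinity. *)
Fixpoint gamma_primitive n x : R :=
  if n is k.+1 then k.+1%:R * gamma_primitive k x - x ^+ k.+1 * expR (- x)
  else - expR (- x).

Lemma gamma_primitive0 n : gamma_primitive n 0 = - n`!%:R.
Proof.
elim: n => [|n IHn] /=; first by rewrite oppr0 expR0.
by rewrite IHn expr0n mul0r subr0 factS natrM mulrN.
Qed.

Lemma cvg_gamma_primitive n : gamma_primitive n x @[x --> +oo] --> (0 : R).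
Proof.
elim: n => [|n IHn] /=; first by rewrite -oppr0; apply: cvgN; exact: cvgr_expR.
rewrite -[0]subr0 -[X in X - _](mulr0 n.+1%:R); apply: cvgB.
  by apply: cvgM => //; exact: cvg_cst.
exact: cvg_exprn_expRN.
Qed.

Lemma is_derive_gamma_primitive n x :
  is_derive x 1 (gamma_primitive n) (x ^+ n * expR (- x)).
Proof.
elim: n => [|n IHn] /=.
  by apply: is_derive_eq; rewrite /GRing.scale /=; ring.
have dE : is_derive x 1 (fun y => expR (- y)) (- expR (- x)).
  by apply: is_derive_eq; rewrite /GRing.scale /=; ring.
have d1 : is_derive x 1 (fun y => n.+1%:R * gamma_primitive n y)
    (n.+1%:R * (x ^+ n * expR (- x))).
  exact: (is_deriveZ _ IHn).
have d2 : is_derive x 1 (fun y : R => y ^+ n.+1) (n.+1%:R * x ^+ n).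
  have := is_deriveX n.+1 (is_derive_id x (1 : R)).
  rewrite [GRing.scale _ _]mulr1 (_ : id ^+ n.+1 = fun y : R => y ^+ n.+1)//.
  by apply/funext => y; rewrite exprfctE.
by apply: (is_derive_eq (is_deriveB d1 (is_deriveM d2 dE)));
  rewrite /GRing.scale /=; ring.
Qed.

Lemma euler_integral_nat n : euler_integral n.+1%:R = n`!%:R :> R.
Proof.
have cf : continuous (fun x => x ^+ n * expR (- x)).
  move=> x; apply: cvgM; first exact: exprn_continuous.
  apply: continuous_comp; first exact: continuousN.
  exact: continuous_expR.
rewrite /euler_integral /Rintegral.
transitivity (fine (\int[lebesgue_measure]_(x in `]0%R, +oo[)
    (x ^+ n * @expR R (- x))%:E)%E).
  congr fine; apply: eq_integral => x; rewrite inE/= in_itv/= andbT => x0.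
  by rewrite -natr1 addrK powR_mulrn ?ltW.
rewrite integral_itv_obnd_cbnd; last first.
  apply/measurable_EFinP; apply: measurable_funTS.
  exact: continuous_measurable_fun.
rewrite (@ge0_continuous_FTC2y _ _ (gamma_primitive n) _ 0).
- by rewrite gamma_primitive0 -EFinB/= sub0r opprK.
- by move=> x x0; rewrite mulr_ge0 ?exprn_ge0 ?expR_ge0.
- exact: continuous_subspaceT.
- exact: cvg_gamma_primitive.
- by move=> x _; apply: ex_derive; exact: is_derive_gamma_primitive.
- apply: cvg_at_right_filter; apply: differentiable_continuous.
  apply/derivable1_diffP; apply: ex_derive; exact: is_derive_gamma_primitive.
- move=> x _; rewrite derive1E; apply: derive_val.
  exact: is_derive_gamma_primitive.
Qed.

(** The half-lines increase to []0, +oo[], so monotone convergence applies. This carries identities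
    proved away from 0 over to the full integral. *)
Lemma cvg_integral_itvcy (f : R -> R) (a : R^nat) :
  (forall x, 0 < x -> 0 <= f x) -> measurable_fun (`]0, +oo[ : set R) f ->
  (forall n, 0 < a n) -> nonincreasing_seq a -> a @ \oo --> 0 ->
  (\int[lebesgue_measure]_(x in `[a n, +oo[) (f x)%:E)%E @[n --> \oo] -->
  (\int[lebesgue_measure]_(x in `]0%R, +oo[) (f x)%:E)%E.
Proof.
move=> f0 mf a0 na a_0.
have -> : `]0%R, +oo[%classic = \bigcup_n `[a n, +oo[%classic.
  apply/seteqP; split => x /=; rewrite in_itv/= andbT.
    move=> x0; have [n _ /(_ n (leqnn n)) ax] := cvgr_lt 0 a_0 x x0.
    by exists n => //=; rewrite in_itv/= andbT ltW.
  by case=> n _; rewrite /= in_itv/= andbT; exact: lt_le_trans.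
apply: ge0_nondecreasing_set_cvg_integral => //.
- move=> m n mn; apply/subsetPset => x /=; rewrite !in_itv/= !andbT.
  by apply: le_trans; exact: na.
- move=> n; apply/measurable_EFinP; apply: measurable_funS mf => //.
  by move=> x /=; rewrite !in_itv/= !andbT; exact: lt_le_trans.
- move=> n x; rewrite /= in_itv/= andbT lee_fin => ax.
  by apply: f0; exact: lt_le_trans ax.
Qed.

Lemma cvgy_sqrt : Num.sqrt x @[x --> +oo] --> (+oo : set_system R).
Proof.
apply/cvgryPge => A; near=> x.
rewrite (le_trans (ler_norm A))// -sqrtr_sqr; apply: ler_wsqrtr.
by near: x; apply: nbhs_pinfty_ge; exact: num_real.
Unshelve. all: by end_near. Qed.

Lemma derive1_sqrt x : 0 < x -> derive1 (@Num.sqrt R) x = (2 * Num.sqrt x)^-1.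
Proof. by move=> x0; rewrite derive1E derive_sqrt. Qed.

Lemma continuous_derive1_sqrt x : 0 < x ->
  {for x, continuous (derive1 (@Num.sqrt R))}.
Proof.
move=> x0; rewrite /prop_for /continuous_at derive1_sqrt//.
apply: (@cvg_trans _ ((2 * Num.sqrt y)^-1 @[y --> x])).
  apply: near_eq_cvg; near=> y; rewrite derive1_sqrt//.
  by near: y; exact: lt_nbhsr.
have s0 : 2 * Num.sqrt x != 0 by rewrite gt_eqF// mulr_gt0// sqrtr_gt0.
have h : (2 * Num.sqrt y : R) @[y --> x] --> 2 * Num.sqrt x.
  by apply: cvgM; [exact: cvg_cst | exact: sqrt_continuous].
exact: cvgV s0 h.
Unshelve. all: by end_near. Qed.

Lemma cvgy_derive1_sqrt : derive1 (@Num.sqrt R) x @[x --> +oo] --> (0 : R).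
Proof.
apply/cvgrPdist_le => e e0; near=> x.
have x0 : 0 < x by near: x; apply: nbhs_pinfty_gt; exact: num_real.
have s0 : 0 < Num.sqrt x by rewrite sqrtr_gt0.
rewrite derive1_sqrt// sub0r normrN gtr0_norm ?invr_gt0 ?mulr_gt0//.
rewrite -[leRHS]invrK lef_pV2 ?posrE ?invr_gt0 ?mulr_gt0//.
rewrite (@le_trans _ _ (Num.sqrt x))//; last by lra.
near: x; exact: (cvgryPge _).1 cvgy_sqrt _.
Unshelve. all: by end_near. Qed.

Lemma euler_integral_half : euler_integral (2^-1) = Num.sqrt pi :> R.
Proof.
pose f (x : R) := x `^ (2^-1 - 1) * expR (- x).
(* The substitution at the level of integrands: the last factor is the derivative of the square
   root. *)
have fE x : 0 < x -> f x = 2 * (gauss_fun (Num.sqrt x) * (2 * Num.sqrt x)^-1).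
  move=> x0; have s0 : Num.sqrt x != 0 by rewrite gt_eqF// sqrtr_gt0.
  rewrite /f /gauss_fun sqr_sqrtr ?ltW// powRB ?(gt_eqF x0)//; last first.
    by apply/implyP.
  rewrite powR12_sqrt ?powRr1 ?ltW// -{2}(sqr_sqrtr (ltW x0)).
  by field.
pose c n : R := n.+1%:R^-1.
have c0 n : 0 < c n by rewrite invr_gt0.
have nc : nonincreasing_seq c.
  by move=> m n mn; rewrite lef_pV2 ?posrE// ler_nat ltnS.
have c_0 : c @ \oo --> 0 by exact: cvg_harmonic.
have cc_0 : (fun n => c n ^+ 2) @ \oo --> 0.
  by rewrite -[0](mulr0 0); under eq_fun do rewrite expr2; exact: cvgM.
have f0 x : 0 < x -> 0 <= f x.
  by move=> x0; rewrite mulr_ge0 ?powR_ge0 ?expR_ge0.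
have mf : measurable_fun (`]0, +oo[ : set R) f.
  apply: measurable_funTS; apply: measurable_funM; first exact: measurable_powR.
  exact: measurableT_comp.
have ncc : nonincreasing_seq (fun n => c n ^+ 2).
  by move=> m n mn; rewrite lerXn2r ?nnegrE ?(ltW (c0 _))// nc.
have := cvg_integral_itvcy f0 mf (fun n => exprn_gt0 2 (c0 n)) ncc cc_0.
have lim2 := cvg_integral_itvcy (fun x _ => gauss_fun_ge0 x)
  (measurable_funTS measurable_gauss_fun) c0 nc c_0.
(* The substitution theorem needs a derivative bounded at the left endpoint, so
   t = u^2 is applied away from 0, on the half-lines from c n ^+ 2. *)
have subst n : (\int[lebesgue_measure]_(x in `[(c n ^+ 2)%R, +oo[) (f x)%:E =
    2%:E * \int[lebesgue_measure]_(x in `[c n, +oo[) (gauss_fun x)%:E)%E.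
  have cn2 : Num.sqrt (c n ^+ 2) = c n by rewrite sqrtr_sqr gtr0_norm.
  have c20 : 0 < c n ^+ 2 by exact: exprn_gt0.
  rewrite -[in RHS]cn2 (@increasing_ge0_integration_by_substitutiony _ Num.sqrt).
  - rewrite -ge0_integralZl_EFin//=.
    + apply: eq_integral => x; rewrite inE/= in_itv/= andbT => cx.
      have x0 := lt_le_trans c20 cx.
      by rewrite fE// -EFinM; congr (_ * (_ * _))%:E; rewrite derive1_sqrt.
    + move=> x; rewrite in_itv/= andbT => cx; have x0 := lt_le_trans c20 cx.
      rewrite lee_fin; apply: mulr_ge0; first exact: gauss_fun_ge0.
      by rewrite derive1_sqrt// invr_ge0 mulr_ge0 ?sqrtr_ge0.
    (* On this half-line the transformed integrand is half of [f], whose measurability is known. *)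
    + apply/measurable_EFinP.
      apply: (eq_measurable_fun (fun x => 2^-1 * f x)) => [x|].
        rewrite inE/= in_itv/= andbT => cx; have x0 := lt_le_trans c20 cx.
        by rewrite fE// mulKf//; congr (_ * _); rewrite derive1_sqrt.
      apply: measurable_funM => //; apply: measurable_funS mf => // x /=.
      by rewrite !in_itv/= !andbT; exact: lt_le_trans.
  - move=> x y; rewrite !in_itv/= !andbT => cx cy xy.
    by rewrite ltr_sqrt// (lt_le_trans c20).
  - move=> x; rewrite in_itv/= andbT => cx.
    by apply: continuous_derive1_sqrt; exact: lt_trans cx.
  - apply/cvg_ex; exists (derive1 (@Num.sqrt R) (c n ^+ 2)).
    by apply: cvg_at_right_filter; exact: continuous_derive1_sqrt.
  - by apply/cvg_ex; exists 0; exact: cvgy_derive1_sqrt.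
  - split.
      move=> x; rewrite in_itv/= andbT => cx; apply: ex_derive.
      by apply: is_derive1_sqrt; exact: lt_trans cx.
    by apply: cvg_at_right_filter; exact: sqrt_continuous.
  - exact: cvgy_sqrt.
  - by apply: continuous_subspaceT; exact: continuous_gauss_fun.
  - by move=> x _; exact: gauss_fun_ge0.
have -> : euler_integral 2^-1 =
    fine (\int[lebesgue_measure]_(x in `]0%R, +oo[) (f x)%:E)%E by [].
under eq_fun do rewrite subst.
move=> lim1.
have lim3 := cvgeZl (isT : 2%:E \is a fin_num) lim2.
(* Both sides of [subst] have limits, hence equal ones; the factor 2 then cancels the half in the
   Gaussian integral over the half-line. *)
rewrite (cvg_unique _ lim1 lim3)//.
rewrite integral_itv_obnd_cbnd ?integral0y_gauss; last first.
  by apply/measurable_EFinP/measurable_funTS; exact: measurable_gauss_fun.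
by rewrite /= mulrC divfK.
Qed.

Lemma Gamma_nat n : Gamma n.+1%:R = n`!%:R :> R.
Proof.
rewrite /Gamma (_ : Num.truncn _ = 0%N); last first.
  by apply/truncn0Pn; rewrite -ltNge gtrBl ltr0n.
by rewrite big_ord0 divr1 addr0 euler_integral_nat.
Qed.

(** The i-th factor is -(2(n - i) - 1)/2, so the product is (-1)^n (2n - 1)!! / 2^n. The induction
    peels off i = 0, since shifting the rest gives the product for [n]. *)
Lemma prod_half_shift n :
  \prod_(i < n) (2^-1 - n%:R + i%:R : R) * ((- 4) ^+ n * n`!%:R) = (2 * n)`!%:R.
Proof.
elim: n => [|n IHn]; first by rewrite big_ord0 expr0 !mulr1 muln0.
rewrite big_ord_recl (eq_bigr (fun i : 'I_n => 2^-1 - n%:R + i%:R)) => [|i _]; last first.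
  by rewrite lift0 -!natr1; ring.
rewrite (_ : 2 * n.+1 = (2 * n).+2)%N; last by rewrite mulnS.
rewrite !factS !natrM -IHn exprS -!natr1 natrM /=.
by field.
Qed.

Lemma Gamma_half n :
  Gamma (2^-1 - n%:R) = (- 4) ^+ n * n`!%:R / (2 * n)`!%:R * Num.sqrt pi :> R.
Proof.
(* Here [1 - x] is n + 1/2, so the continuation takes exactly [n] steps and ends at 1/2. *)
rewrite /Gamma (_ : Num.truncn _ = n); last first.
  by apply: truncn_def; rewrite -(natr1 n); apply/andP; split; lra.
rewrite subrK euler_integral_half mulrC; congr (_ * _).
have := prod_half_shift n; set P := \prod_(i < n) _ => PE.
have PNZ : P != 0.
  apply/eqP => P0; move/eqP: PE; rewrite P0 mul0r eq_sym pnatr_eq0.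
  by rewrite (gtn_eqF (fact_gt0 _)).
rewrite -PE; field; rewrite PNZ /=.
by rewrite pnatr_eq0 (gtn_eqF (fact_gt0 _)) expf_neq0.
Qed.

Lemma pochhammer_nat n k : pochhammer n.+1%:R k = (n + k)`!%:R / n`!%:R :> R.
Proof. by rewrite /pochhammer -natrD addSn !Gamma_nat. Qed.

End gamma.

(** * From Theta to binomial products, and evaluation of the sums *)

Section Corollary.
Variable R : realType.

Lemma natr_fact_neq0 i : i`!%:R != 0 :> R.
Proof. by rewrite pnatr_eq0 gtn_eqF ?fact_gt0. Qed.

Lemma natr_bin i s : 'C(i + s, s)%:R = (i + s)`!%:R / (s`!%:R * i`!%:R) :> R.
Proof.
apply: (canRL (mulfK _)); first by rewrite mulf_neq0 ?natr_fact_neq0.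
by rewrite -!natrM -[in RHS](bin_fact (leq_addl i s)) addnK.
Qed.

(** Both Pochhammer symbols have positive integer arguments, hence are quotients of factorials: the
    first is s! times a binomial, the second becomes a binomial once divided by its factorial. *)
Lemma ThetaE s n p : (p <= n)%N ->
  Theta R (n + s.+1) p s.+1 = (- 4) ^+ s.+1 * s`!%:R * p.+1%:R *
    (if odd (n - p) then 0
     else ('C((n + p)./2.+1 + s, s) * 'C((n - p)./2 + s, s))%:R).
Proof.
move=> lepn; rewrite /Theta /theta.
have -> : (n + s.+1 - p - s.+1 = n - p)%N by lia.
case: ifPn => [_|evnp]; first by rewrite !mulr0.
have -> : (n + s.+1 + p - s.+1 = n + p)%N by lia.
(* For even n - p the sign thus depends on r = [s.+1] alone and combines with 2^(2r) into (-4)^r. *)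
have -> : (n + s.+1 - p = 2 * (n - p)./2 + s.+1)%N by lia.
have -> : (n + p)%:R / 2 + 2 = (n + p)./2.+2%:R :> R.
  rewrite [in LHS](_ : n + p = (n + p)./2 * 2)%N; last by lia.
  by rewrite natrM mulfK// -natrD addn2.
rewrite subn1 !pochhammer_nat natrM !natr_bin exprD exprM sqrrN !expr1n mul1r.
rewrite [(s + _)%N]addnC exprM (_ : (- 4 : R) = -1 * 2 ^+ 2); last by ring.
by rewrite [in RHS]exprMn; field; rewrite !natr_fact_neq0.
Qed.

(** Common form of the three special cases: [F] is the polynomial weight, to be matched with the
    binomial product through j = (n + p)/2 and k = (n - p)/2, where n = m - r. *)
Lemma sum_theta (c : R) s m (F : nat -> R) : (s < m)%N ->
  (forall j k, (j + k = m - s.+1)%N -> (k <= j)%N ->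
    F (j - k)%N = c * ('C(j.+1 + s, s) * 'C(k + s, s))%:R) ->
  \sum_(0 <= p < (m - s.+1).+1)
    (-1) ^+ (m - p) * p.+1%:R ^+ 2 * F p * theta R m p s.+1 =
  (-1) ^+ s.+1 * c * s.+1%:R * 'C(m + s + 2, 2 * s + 3)%:R.
Proof.
move=> ltsm FE; set n := (m - s.+1)%N in FE *.
rewrite (_ : m + s + 2 = n + 2 * s + 3)%N; last by lia.
rewrite -mulrA -sum_sqr_bin_parity mulr_sumr.
apply: eq_big_nat => p /andP[_ lepn].
rewrite /theta (_ : m - p - s.+1 = n - p)%N; last by lia.
case: ifPn => [_|evnp]; first by rewrite !mulr0.
have -> : (m - p = 2 * (n - p)./2 + s.+1)%N by lia.
rewrite [in F p](_ : p = (n + p)./2 - (n - p)./2)%N; last by lia.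
rewrite FE; [|lia|lia].
by rewrite exprD exprM sqrrN !expr1n mul1r; ring.
Qed.

End Corollary.

Theorem corollary2p3 (R : realType) :
  (forall r m : nat, (1 <= r)%N -> (r <= m)%N ->
     \sum_(0 <= p < (m - r).+1) Theta R m p r * p.+1%:R =
     - (Gamma (- r%:R - 2^-1 : R) * (m + r + 1)`!%:R
        / (2 * Num.sqrt pi * (m - r)`!%:R)))
  /\
  (forall m : nat, (1 <= m)%N ->
     \sum_(0 <= p < (m - 1).+1) (-1) ^+ (m - p) * p.+1%:R ^+ 2 * theta R m p 1 =
     - ((m%:R + 2) * (m%:R + 1) * m%:R / 6))
  /\
  (forall m : nat, (2 <= m)%N ->
     \sum_(0 <= p < (m - 2).+1)
        (-1) ^+ (m - p) * p.+1%:R ^+ 2 * (m%:R - p%:R) * (m%:R + p%:R + 2)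
        * theta R m p 2 =
     (m%:R - 1) * m%:R * (m%:R + 1) * (m%:R + 2) * (m%:R + 3) / 15)
  /\
  (forall m : nat, (3 <= m)%N ->
     \sum_(0 <= p < (m - 3).+1)
        (-1) ^+ (m - p) * p.+1%:R ^+ 2
        * (p%:R - m%:R - 1) * (p%:R - m%:R + 1)
        * (m%:R + p%:R + 1) * (m%:R + p%:R + 3) * theta R m p 3 =
     - (4 * (m%:R - 2) * (m%:R - 1) * m%:R * (m%:R + 1) * (m%:R + 2)
        * (m%:R + 3) * (m%:R + 4) / 105)).
Proof.
split=> [[//|s] m _ lesm|].
  rewrite -(subnK lesm); set n := (m - s.+1)%N; rewrite addnK.
  rewrite (eq_big_nat _ _ (F2 := fun p => (- 4) ^+ s.+1 * s`!%:R * (p.+1%:R ^+ 2 *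
    (if odd (n - p) then 0
     else ('C((n + p)./2.+1 + s, s) * 'C((n - p)./2 + s, s))%:R)))); last first.
    by move=> p /andP[_ lepn]; rewrite ThetaE//; ring.
  rewrite -mulr_sumr sum_sqr_bin_parity.
  rewrite (_ : - s.+1%:R - 2^-1 = 2^-1 - s.+2%:R :> R); last first.
    by rewrite -[s.+2%:R]natr1; lra.
  rewrite Gamma_half (_ : n + s.+1 + s.+1 + 1 = n + (2 * s + 3))%N; last by lia.
  rewrite -addnA natr_bin (_ : 2 * s.+2 = (2 * s + 3).+1)%N; last by lia.
  have pi0 : Num.sqrt (pi : R) != 0 by rewrite gt_eqF// sqrtr_gt0 pi_gt0.
  (* The quotient (s+2)! / (2s+4)! reduces to (s+1)! / (2 (2s+3)!); this half, the half in the
     statement and the minus sign cancel the extra factor -4. *)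
  rewrite !factS !natrM !exprS.
  field.
  rewrite !natr_fact_neq0 pi0/= gt_eqF//; have := ler0n R s; lra.
split=> [[//|n] _|].
  under eq_bigr => p _ do rewrite -[_ * p.+1%:R ^+ 2]mulr1.
  rewrite (@sum_theta _ 1 0 _ (fun=> 1)) => [|//|j k _ _]; last by rewrite !bin0 mulr1.
  rewrite (_ : n.+1 + 0 + 2 = n + 3)%N; last by lia.
  rewrite natr_bin addn3 !factS !natrM -!natr1; field.
  by rewrite natr_fact_neq0.
split=> [[//|[//|n]] _|[//|[//|[//|n]]] _].
  pose F p : R := (n.+2%:R - p%:R) * (n.+2%:R + p%:R + 2).
  rewrite (eq_bigr (fun p => (-1) ^+ (n.+2 - p) * p.+1%:R ^+ 2 * F p
    * theta R n.+2 p 2));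
    last by move=> p _; rewrite -!mulrA.
  (* The weight is (2k + 2)(2j + 4), which is 4 times the product of the binomials k + 1 and j +
     2. *)
  rewrite (@sum_theta _ 4 1) => [|//|j k jkn lekj].
    rewrite (_ : n.+2 + 1 + 2 = n + 5)%N; last by lia.
    rewrite natr_bin (_ : n + 5 = n.+4.+1)%N; last by lia.
    rewrite !factS !natrM -!natr1; field.
    by rewrite natr_fact_neq0.
  rewrite /F natrB// !bin1 (_ : n = j + k)%N; last by lia.
  by rewrite !natrM -!natr1 !natrD; ring.
pose F p : R := (p%:R - n.+3%:R - 1) * (p%:R - n.+3%:R + 1)
        * (n.+3%:R + p%:R + 1) * (n.+3%:R + p%:R + 3).
rewrite (eq_bigr (fun p => (-1) ^+ (n.+3 - p) * p.+1%:R ^+ 2 * F p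
    * theta R n.+3 p 3));
  last by move=> p _; rewrite -!mulrA.
(* The weight is 16 (k + 1)(k + 2)(j + 2)(j + 3), and each binomial with lower index 2 contributes a
   further factor 2. *)
rewrite (@sum_theta _ 64 2) => [|//|j k jkn lekj].
  rewrite (_ : n.+3 + 2 + 2 = n + 7)%N; last by lia.
  rewrite natr_bin (_ : n + 7 = n.+4.+3)%N; last by lia.
  rewrite !factS !natrM -!natr1; field.
  by rewrite natr_fact_neq0.
rewrite /F natrB// natrM !natr_bin (_ : n = j + k)%N; last by lia.
rewrite !addn2 !factS !natrM -!natr1 !natrD; field.
by rewrite !natr_fact_neq0 natr1 pnatr_eq0.
Qed.
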